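(* For every integer $n \geq 1$, if $P_n$ is the path of order $n$ (i.e. with $n$ vertices), then $d(P_n) = \lceil \frac{n}{2} \rceil$.
   Context: Graphs are finite and simple. The deduction game on a graph $G$: a layout is a placement of searchers on vertices of $G$ (a vertex may receive several searchers). A vertex is occupied in the layout if it contains at least one searcher, and unoccupied otherwise. A vertex is protected if it is occupied in the initial layout or if a searcher has moved there at some point, and unprotected otherwise. A vertex is fireable if the number of searchers on it is greater than or equal to the number of its unprotected neighbours. Initially every searcher is mobile; once a searcher has moved once, it becomes immobile (cannot move again). At each stage, simultaneously, for every fireable vertex $v$ containing mobile searchers, one searcher moves from $v$ to each unprotected neighbour of $v$ (excess searchers stay on $v$; several fireable vertices may send a searcher to the same target). Stages continue until no new searchers move. The layout is successful if at the end all vertices of $G$ are protected. The deduction number $d(G)$ is the minimum number of searchers in a successful layout on $G$. *)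

(* Defs.v *)
From HB Require Import structures.
From mathcomp Require Import all_boot.

Set Implicit Arguments.
Unset Strict Implicit.
Unset Printing Implicit Defensive.

Record sgraph := SGraph {
  vertex :> finType;
  adj : rel vertex;
  adj_sym : symmetric adj;
  adj_irr : irreflexive adj }.

Section Game.
Variable G : sgraph.

(* [l v] is the number of searchers placed on [v]. *)
Definition layout := {ffun G -> nat}.

Definition searchers (l : layout) : nat := \sum_(v : G) l v.

Record state := State {
  mobile : {ffun G -> nat};
  immobile : {ffun G -> nat};
  protected : {set G} }.

Definition start (l : layout) : state :=
  State l [ffun=> 0] [set v | 0 < l v].

Definition unprotected_nbrs (s : state) (v : G) : {set G} :=
  [set w | adj v w & w \notin protected s].

Definition fireable (s : state) (v : G) : bool :=
  #|unprotected_nbrs s v| <= mobile s v + immobile s v.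

Definition fires (s : state) (v : G) : bool := fireable s v && (0 < mobile s v).

(* The vertices from which a searcher moves to [w] during the next stage. *)
Definition senders (s : state) (w : G) : {set G} :=
  [set v | fires s v & w \in unprotected_nbrs s v].

(* The truncated subtraction is exact on every state reached from a layout:
   see [fires_mobile] below. *)
Definition stage (s : state) : state :=
  State [ffun v => if fires s v then mobile s v - #|unprotected_nbrs s v|
                   else mobile s v]
        [ffun w => immobile s w + #|senders s w|]
        (protected s :|: [set w | senders s w != set0]).

(* Each stage in which a searcher moves protects a new vertex, so the game is
   over after #|G| stages: see [stage_outcome] below. *)
Definition outcome (l : layout) : state := iter #|G| stage (start l).

Definition successful (l : layout) : bool := protected (outcome l) == setT.

(* Bounding the values of the layout by [k] makes its choice finite; it is no
   restriction, since there are [k] searchers: see [deduction_numberP]. *)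
Definition has_successful_layout (k : nat) : bool :=
  [exists l : {ffun G -> 'I_k.+1},
     let l' : layout := [ffun v => val (l v)] in
     (searchers l' == k) && successful l'].

Lemma protected_stage s : protected s \subset protected (stage s).
Proof. exact: subsetUl. Qed.

Lemma protected_iter k s : protected s \subset protected (iter k stage s).
Proof.
elim: k => //= k IHk; exact: subset_trans IHk (protected_stage _).
Qed.

Lemma has_successful_layoutP k :
  reflect (exists2 l, successful l & searchers l = k)
          (has_successful_layout k).
Proof.
apply: (iffP existsP) => [[l /andP[/eqP szl okl]]|[l okl szl]].
  by exists [ffun v => val (l v)].
have lt_l v : l v < k.+1 by rewrite ltnS -szl /searchers (bigD1 v) //= leq_addr.
exists [ffun v => Ordinal (lt_l v)].
suff -> : [ffun v => val ([ffun v => Ordinal (lt_l v)] v)] = l :> layout.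
  by rewrite /= szl eqxx okl.
by apply/ffunP => v; rewrite !ffunE.
Qed.

Lemma ex_successful_layout : exists k, has_successful_layout k.
Proof.
exists (searchers [ffun=> 1]); apply/has_successful_layoutP.
exists [ffun=> 1] => //; rewrite /successful -subTset.
apply: subset_trans (protected_iter _ _).
by apply/subsetP => v _; rewrite inE ffunE.
Qed.

Definition deduction_number : nat := ex_minn ex_successful_layout.

Lemma deduction_numberP :
  (exists2 l, successful l & searchers l = deduction_number) /\
  (forall l, successful l -> deduction_number <= searchers l).
Proof.
rewrite /deduction_number; case: ex_minnP => m /has_successful_layoutP ? min_m.
split=> // l okl; apply: min_m; apply/has_successful_layoutP; by exists l.
Qed.

Lemma mobile_immobile k l v (s := iter k stage (start l)) :
  0 < mobile s v -> immobile s v = 0 /\ v \in protected s.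
Proof.
rewrite {}/s; elim: k => [|k IHk] /=; first by rewrite ffunE inE.
set s := iter k stage _ in IHk *; rewrite !ffunE => mob'.
have /IHk[-> prot_v] : 0 < mobile s v.
  by move: mob'; case: ifP => // _ /leq_trans; apply; apply: leq_subr.
rewrite in_setU prot_v; split=> //; apply/eqP; rewrite cards_eq0 -subset0.
by apply/subsetP => u; rewrite !inE prot_v !andbF.
Qed.

Lemma fires_mobile k l v (s := iter k stage (start l)) :
  fires s v -> #|unprotected_nbrs s v| <= mobile s v.
Proof.
by case/andP=> + /mobile_immobile[im0 _]; rewrite /fireable im0 addn0.
Qed.

Lemma stage_fixed s : protected (stage s) = protected s -> stage s = s.
Proof.
move=> fix_s; have nosend w : senders s w = set0.
  apply/eqP/negPn/negP => nz; have: w \in protected (stage s).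
    by rewrite in_setU [X in _ || X]inE nz orbT.
  rewrite fix_s => prot_w; case/set0Pn: nz => u.
  by rewrite !inE prot_w !andbF.
case: s fix_s nosend => m im p fix_s nosend; rewrite -[RHS]/(State m im p).
congr State; last exact: fix_s.
  apply/ffunP=> v; rewrite ffunE; case: ifP => // fv.
  rewrite (_ : unprotected_nbrs _ v = set0) ?cards0 ?subn0 //.
  apply/setP => w; move/setP/(_ v): (nosend w).
  by rewrite [X in X = _]inE fv /= => ->; rewrite !inE.
by apply/ffunP=> v; rewrite ffunE nosend cards0 addn0.
Qed.

Lemma stage_outcome l : stage (outcome l) = outcome l.
Proof.
suff prog k s : stage (iter k stage s) = iter k stage s \/
                k < #|protected (iter k.+1 stage s)|.
  by case: (prog #|G| (start l)) => //; rewrite ltnNge max_card.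
elim: k => [|k [IHk|IHk]] /=; last 1 first.
- set t := stage (iter k stage s) in IHk *.
  have [eq_t|ne_t] := eqVneq (protected (stage t)) (protected t).
    by left; apply: stage_fixed.
  right; apply: leq_ltn_trans IHk _; apply: proper_card.
  by rewrite properEneq eq_sym ne_t protected_stage.
- have [eq_s|ne_s] := eqVneq (protected (stage s)) (protected s).
    by left; apply: stage_fixed.
  right; apply: leq_ltn_trans (leq0n #|protected s|) _; apply: proper_card.
  by rewrite properEneq eq_sym ne_s protected_stage.
by left; rewrite !IHk.
Qed.

End Game.

Definition path_adj n : rel 'I_n := fun i j => (i.+1 == j) || (j.+1 == i).

Lemma path_adj_sym n : symmetric (@path_adj n).
Proof. by move=> i j; rewrite /path_adj orbC. Qed.

Lemma path_adj_irr n : irreflexive (@path_adj n).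
Proof. by move=> i; rewrite /path_adj orbb gtn_eqF. Qed.

Definition path_graph n : sgraph := SGraph (@path_adj_sym n) (@path_adj_irr n).

(* Main.v *)
Require Import Defs.
From mathcomp Require Import all_boot.
From mathcomp Require Import zify.

(** Lower bound, valid on every graph [G]: a searcher protects at most two
    vertices, the one where it starts and the one where it ends.  Formally, the
    number of protected vertices plus the number of mobile searchers never
    increases ([potential_stage]), since a newly protected vertex costs at least
    one mobile searcher.  This quantity is at most twice the number of searchers
    at the start, and at least #|G| at the end of a successful game, whence
    [card_le_searchers].

    Upper bound: on the path 0, ..., n-1, put one searcher on every even vertex.
    This uses [uphalf n] searchers.  Instead of following the stages, look at the
    final state, where no further move is possible ([outcome_stuck]): were [w]
    the least unprotected vertex, it would be odd and [w.-1] would have [w] as its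
    only unprotected neighbour.  A searcher leaves [w.-1] only when all its
    unprotected neighbours become protected, so [w.-1] would still have its
    searcher and could send it to [w]. *)

Set Implicit Arguments.
Unset Strict Implicit.
Unset Printing Implicit Defensive.

Section AnyGraph.
Variable G : sgraph.
Implicit Types (s : state G) (l : layout G).

Definition potential s : nat := #|protected s| + \sum_v mobile s v.

(** The hypothesis says that no vertex sends more searchers than it has; without
    it the truncated subtraction in [stage] would create moves at no cost. *)
Lemma potential_stage s :
    (forall v, fires s v -> #|unprotected_nbrs s v| <= mobile s v) ->
  potential (stage s) <= potential s.
Proof.
move=> enough; rewrite /potential.
pose moves := \sum_(v | fires s v) #|unprotected_nbrs s v|.
have mobileE : \sum_v mobile (stage s) v + moves = \sum_v mobile s v.
  rewrite [moves]big_mkcond -big_split; apply: eq_bigr => v _ /=.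
  by rewrite ffunE; case: ifP => [/enough/subnK|_]; rewrite ?addn0.
have new_le : #|[set w | senders s w != set0]| <= moves.
  apply: (@leq_trans #|\bigcup_(v | fires s v) unprotected_nbrs s v|).
    apply/subset_leq_card/subsetP => w; rewrite inE => /set0Pn[v].
    by rewrite inE => /andP[fv wv]; apply/bigcupP; exists v.
  rewrite /moves; elim/big_rec2: _ => [|v m A _ leA]; first by rewrite cards0.
  by apply: leq_trans (leq_card_setU _ _) _; rewrite leq_add2l.
rewrite -mobileE [_ + moves]addnC addnA leq_add2r.
by apply: leq_trans (leq_card_setU _ _) _; rewrite leq_add2l.
Qed.

Lemma potential_start l : potential (start l) <= (searchers l).*2.
Proof.
rewrite /potential -addnn leq_add2r -sum1_card /= big_mkcond /=.
by apply: leq_sum => v _; rewrite inE; case: ifP.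
Qed.

Lemma card_le_searchers l : successful l -> #|G| <= (searchers l).*2.
Proof.
move/eqP=> okl; apply: leq_trans (potential_start l).
have : potential (outcome l) <= potential (start l).
  rewrite /outcome; elim: #|G| => //= k; apply: leq_trans.
  by apply: potential_stage => v; apply: fires_mobile.
by apply: leq_trans; rewrite /potential okl cardsT leq_addr.
Qed.

Lemma unprotected_nbrs_stage s v :
  unprotected_nbrs (stage s) v \subset unprotected_nbrs s v.
Proof.
apply/subsetP => w; rewrite !inE => /andP[-> /=].
by rewrite negb_or => /andP[].
Qed.

Lemma fires_protects s v :
  fires s v -> unprotected_nbrs (stage s) v = set0.
Proof.
move=> fv; apply/setP => w; rewrite inE in_set0; apply/negP => /andP[vw].
rewrite in_setU negb_or => /andP[unw]; rewrite inE => /negP[].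
by apply/set0Pn; exists v; rewrite !inE fv vw unw.
Qed.

(** A vertex loses searchers only by firing, and firing protects all its
    neighbours at once, so a
    vertex still has all its initial searchers or needs none any more. *)
Lemma mobile_or_protected k l v (s := iter k (@stage G) (start l)) :
  mobile s v = l v \/ unprotected_nbrs s v = set0.
Proof.
rewrite {}/s; elim: k => [|k IHk] /=; first by left.
set s := iter k _ _ in IHk *.
have [fv|nfv] := boolP (fires s v); first by right; apply: fires_protects.
case: IHk => [mob|prot]; first by left; rewrite ffunE (negPf nfv).
by right; apply/eqP; rewrite -subset0 -prot unprotected_nbrs_stage.
Qed.

Lemma outcome_stuck l v :
    0 < l v -> #|unprotected_nbrs (outcome l) v| <= l v ->
  unprotected_nbrs (outcome l) v = set0.
Proof.
move=> lv few.
have [mob|//] := mobile_or_protected #|G| l v; rewrite -/(outcome l) in mob.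
have fv : fires (outcome l) v.
  by rewrite /fires /fireable mob lv andbT (leq_trans few) ?leq_addr.
by rewrite -[in LHS]stage_outcome fires_protects.
Qed.

End AnyGraph.

Definition even_layout n : layout (path_graph n) :=
  [ffun v : 'I_n => nat_of_bool (~~ odd v)].

Lemma searchers_even_layout n : searchers (even_layout n) = uphalf n.
Proof.
rewrite /searchers; under eq_bigr do rewrite ffunE.
rewrite /=; elim: n => [|n IHn]; first by rewrite big_ord0.
by rewrite big_ord_recr /= IHn uphalf_half; case: odd; lia.
Qed.

Lemma successful_even_layout n : successful (even_layout n).
Proof.
rewrite /successful -subTset; apply/subsetP => w _.
set s := outcome _.
have prot_even (u : path_graph n) : ~~ odd (u : 'I_n) -> u \in protected s.
  move=> ev; apply: (subsetP (protected_iter _ _)).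
  by rewrite inE ffunE ev.
(* Strong induction on [w] amounts to taking the least unprotected vertex. *)
have [m lt_wm] := ubnP (val (w : 'I_n)).
elim: m w lt_wm => // m IHm w lt_wm.
have [oddw|/prot_even//] := boolP (odd (w : 'I_n)).
have w_gt0 : 0 < (w : 'I_n) by case: (w : 'I_n) oddw => -[].
have lt_un : (w : 'I_n).-1 < n by rewrite (leq_ltn_trans (leq_pred _)).
pose u : path_graph n := Ordinal lt_un.
have lu : even_layout n u = 1.
  by rewrite ffunE /= -[odd _]negbK -oddS prednK // oddw.
have uw : adj u w by rewrite /= /path_adj /= prednK ?eqxx.
apply/negPn/negP => unw.
(* The left neighbour [w.-2] of [u], if any, is protected by induction. *)
have few : unprotected_nbrs s u \subset [set w].
  apply/subsetP => x; rewrite !inE => /andP[/orP[]/eqP xw unx].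
    by apply/eqP/val_inj; rewrite /= -xw /= prednK.
  case/negP: unx; apply: IHm; move: lt_wm xw => /=; lia.
have : w \in unprotected_nbrs s u by rewrite inE uw unw.
by rewrite outcome_stuck ?inE ?lu // -(cards1 w) subset_leq_card.
Qed.

Theorem theorem4p1 (n : nat) (hn : 1 <= n) :
  deduction_number (path_graph n) = uphalf n.
Proof.
have [[l okl szl] min_l] := deduction_numberP (path_graph n).
apply/eqP; rewrite eqn_leq; apply/andP; split.
  rewrite -(searchers_even_layout n).
  exact: min_l (successful_even_layout n).
rewrite -szl leq_uphalf_double.
by have := card_le_searchers okl; rewrite card_ord.
Qed.
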